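(* Let $E$ be a directed partially ordered vector space, let $F$ be a monotone complete (resp. $\sigma$-monotone complete) partially ordered vector space, and let $V$ be a linear subspace of $\mathcal L(E,F)$ containing $\mathcal L_{\mathrm r}(E,F)$. Let $(T_\lambda)_{\lambda\in\Lambda}$ be an increasing net (resp. let $(T_n)_{n=1}^\infty$ be an increasing sequence) in $V$. Then $(T_\lambda)_{\lambda\in\Lambda}$ (resp. $(T_n)_{n=1}^\infty$) is bounded from above in $V$ if and only if, for all $x\in E^+$, $(T_\lambda x)_{\lambda\in\Lambda}$ (resp. $(T_nx)_{n=1}^\infty$) is bounded from above in $F$. In this case, $(T_\lambda)_{\lambda\in\Lambda}$ (resp. $(T_n)_{n=1}^\infty$) has a supremum $T$ in $V$. For $x\in E^+$, it is given by $Tx=\bigvee_{\lambda\in\Lambda}T_\lambda x$ (resp. $Tx=\bigvee_{n=1}^\infty T_nx$). In particular, $V$ is a monotone complete (resp. $\sigma$-monotone complete) partially ordered vector space.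
   Context: All vector spaces are real. A partially ordered vector space $E$ has a proper positive cone $E^+$ (i.e. $E^+\cap(-E^+)=\{0\}$); it is directed if $E=E^+-E^+$. $E$ is monotone complete (resp. $\sigma$-monotone complete) if every increasing net (resp. sequence) in $E$ that is bounded from above has a supremum in $E$. $\mathcal L(E,F)$ is the vector space of all linear maps from $E$ to $F$; $T\in\mathcal L(E,F)$ is positive if $T(E^+)\subseteq F^+$, and regular if it is the difference of two positive linear maps; $\mathcal L_{\mathrm r}(E,F)$ is the space of regular operators. When $E$ is directed, subspaces of $\mathcal L(E,F)$ are partially ordered by the cone of positive operators in them. *)

(* Defs.v *)
From HB Require Import structures.
From mathcomp Require Import all_boot all_order all_algebra.
From mathcomp Require Import boolp classical_sets functions reals prodnormedzmodule.

Set Implicit Arguments.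
Unset Strict Implicit.
Unset Printing Implicit Defensive.

Import Order.TTheory GRing.Theory Num.Theory.

Local Open Scope classical_set_scope.
Local Open Scope ring_scope.

(* The positive cone of [E] is [[set x : E | 0 <= x]]; that it is proper is the
   antisymmetry of [<=]. *)
HB.mixin Record Lmodule_isPOrdered (R : realType) E
    of Num.POrderedZmodule E & GRing.Lmodule R E := {
  lev_add2l : forall z x y : E, x <= y -> z + x <= z + y;
  scalev_ge0 : forall (a : R) (x : E), 0 <= a -> 0 <= x -> 0 <= a *: x
}.

#[short(type="povsType")]
HB.structure Definition POVS (R : realType) :=
  {E of Num.POrderedZmodule E & GRing.Lmodule R E & Lmodule_isPOrdered R E}.

HB.mixin Record POVS_isDirected (R : realType) E of POVS R E := {
  povs_directed :
    forall x : E, exists y z : E, [/\ 0 <= y, 0 <= z & x = y - z]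
}.

#[short(type="directedPovsType")]
HB.structure Definition DirectedPOVS (R : realType) :=
  {E of POVS R E & POVS_isDirected R E}.

Lemma subv_ge0 (R : realType) (E : povsType R) (x y : E) :
  (0 <= y - x) = (x <= y).
Proof.
apply/idP/idP => [/(lev_add2l x)|/(lev_add2l (- x))].
  by rewrite addr0 subrKC.
by rewrite addNr addrC.
Qed.

Section Nets.

Definition directed_set (L : Type) (le : L -> L -> Prop) : Prop :=
  [/\ inhabited L, (forall i, le i i),
      (forall i j k, le i j -> le j k -> le i k) &
      forall i j, exists k, le i k /\ le j k].

Definition increasing_net (R : realType) (E : povsType R)
    (L : Type) (le : L -> L -> Prop) (u : L -> E) : Prop :=
  forall i j, le i j -> u i <= u j.

Definition increasing_seq (R : realType) (E : povsType R) (u : nat -> E) : Prop :=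
  forall m n, (m <= n)%N -> u m <= u n.

Definition monotone_complete (R : realType) (E : povsType R) : Prop :=
  forall (L : Type) (le : L -> L -> Prop) (u : L -> E),
    directed_set le -> increasing_net le u -> has_ubound (range u) ->
    exists s : E, supremums (range u) s.

Definition sigma_monotone_complete (R : realType) (E : povsType R) : Prop :=
  forall u : nat -> E,
    increasing_seq u -> has_ubound (range u) ->
    exists s : E, supremums (range u) s.

End Nets.

Section LinearMaps.
Variables (R : realType) (E F : lmodType R).
Implicit Types f g h : {linear E -> F}.

Lemma linmapP f g : f =1 g -> f = g.
Proof.
case: f g => [f [[Df0] [Zf]]] [g [[Dg0] [Zg]]] /= /funext fg.
move: Df0 Zf Dg0 Zg; rewrite fg => Df0 Zf Dg0 Zg.
by rewrite (Prop_irrelevance Df0 Dg0) (Prop_irrelevance Zf Zg).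
Qed.

Definition linmap_zero : {linear E -> F} := \0.
Definition linmap_opp f : {linear E -> F} := \- f.
Definition linmap_add f g : {linear E -> F} := f \+ g.
Definition linmap_scale (a : R) f : {linear E -> F} := a \*: f.

Fact linmap_addA : associative linmap_add.
Proof. by move=> f g h; apply: linmapP => x /=; rewrite addrA. Qed.
Fact linmap_addC : commutative linmap_add.
Proof. by move=> f g; apply: linmapP => x /=; rewrite addrC. Qed.
Fact linmap_add0 : left_id linmap_zero linmap_add.
Proof. by move=> f; apply: linmapP => x /=; rewrite add0r. Qed.
Fact linmap_addN : left_inverse linmap_zero linmap_opp linmap_add.
Proof. by move=> f; apply: linmapP => x /=; rewrite addNr. Qed.

HB.instance Definition _ := GRing.isZmodule.Build {linear E -> F}
  linmap_addA linmap_addC linmap_add0 linmap_addN.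

Fact linmap_scaleA a b f :
  linmap_scale a (linmap_scale b f) = linmap_scale (a * b) f.
Proof. by apply: linmapP => x /=; rewrite scalerA. Qed.
Fact linmap_scale1 : left_id 1 linmap_scale.
Proof. by move=> f; apply: linmapP => x /=; rewrite scale1r. Qed.
Fact linmap_scaleDr : right_distributive linmap_scale +%R.
Proof. by move=> a f g; apply: linmapP => x /=; rewrite scalerDr. Qed.
Fact linmap_scaleDl f :
  {morph (fun a : R => linmap_scale a f) : a b / a + b}.
Proof. by move=> a b; apply: linmapP => x /=; rewrite scalerDl. Qed.

HB.instance Definition _ := GRing.Zmodule_isLmodule.Build R {linear E -> F}
  linmap_scaleA linmap_scale1 linmap_scaleDr linmap_scaleDl.

Lemma linmap_addE f g x : (f + g) x = f x + g x. Proof. by []. Qed.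
Lemma linmap_subE f g x : (f - g) x = f x - g x. Proof. by []. Qed.
Lemma linmap_scaleE a f x : (a *: f) x = a *: f x. Proof. by []. Qed.

End LinearMaps.

Definition positive_op (R : realType) (E F : povsType R)
    (T : {linear E -> F}) : Prop := forall x, 0 <= x -> 0 <= T x.

Definition regular_op (R : realType) (E F : povsType R)
    (T : {linear E -> F}) : Prop :=
  exists T1 T2 : {linear E -> F},
    [/\ positive_op T1, positive_op T2 & T = T1 - T2].

(* The subspace [V] of L(E, F) as a vector space in its own right.  Order
   notions on [opspace V] (upper bounds, suprema) are thus relative to [V]. *)
Definition opspace (R : realType) (E : directedPovsType R) (F : povsType R)
  (V : submodClosed {linear E -> F}) : Type := {T : {linear E -> F} | T \in V}.

Section OperatorSpace.
Variables (R : realType) (E : directedPovsType R) (F : povsType R).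
Variable V : submodClosed {linear E -> F}.
Local Notation W := (opspace V).

HB.instance Definition _ := SubChoice.on W.
HB.instance Definition _ := [SubChoice_isSubLmodule of W by <:].

Definition opspace_le (S T : W) : bool := `[< positive_op (val T - val S) >].

Lemma opspace_leP (S T : W) :
  reflect (forall x : E, 0 <= x -> val S x <= val T x) (opspace_le S T).
Proof.
apply: (iffP (asboolP _)) => ST x x0; have := ST x x0.
  by rewrite linmap_subE subv_ge0.
by rewrite linmap_subE subv_ge0.
Qed.

Fact opspace_le_refl : reflexive opspace_le.
Proof. by move=> S; apply/opspace_leP. Qed.

Fact opspace_le_trans : transitive opspace_le.
Proof.
move=> T S U /opspace_leP ST /opspace_leP TU; apply/opspace_leP => x x0.
exact: le_trans (ST x x0) (TU x x0).
Qed.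

Fact opspace_le_anti : antisymmetric opspace_le.
Proof.
move=> S T /andP[/opspace_leP ST /opspace_leP TS]; apply/val_inj/linmapP => x.
have eqp z : 0 <= z -> val S z = val T z.
  by move=> z0; apply/le_anti; rewrite ST ?TS.
have [y [z [y0 z0 ->]]] := povs_directed x.
by rewrite !linearB !eqp.
Qed.

HB.instance Definition _ := Order.Le_isPOrder.Build ring_display W
  opspace_le_refl opspace_le_anti opspace_le_trans.

Fact opspace_lev_add2l (U S T : W) : S <= T -> U + S <= U + T.
Proof.
move=> /opspace_leP ST; apply/opspace_leP => x x0.
exact/lev_add2l/ST.
Qed.

Fact opspace_scalev_ge0 (a : R) (T : W) : 0 <= a -> 0 <= T -> 0 <= a *: T.
Proof.
move=> a0 /opspace_leP T0; apply/opspace_leP => x x0.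
exact/scalev_ge0/T0.
Qed.

HB.instance Definition _ := Lmodule_isPOrdered.Build R W
  opspace_lev_add2l opspace_scalev_ge0.

End OperatorSpace.

(* Main.v *)
Require Import Defs.
From HB Require Import structures.
From mathcomp Require Import all_boot all_order all_algebra.
From mathcomp Require Import boolp classical_sets functions reals.

Set Implicit Arguments.
Unset Strict Implicit.
Unset Printing Implicit Defensive.

Import Order.TTheory GRing.Theory Num.Theory.

Local Open Scope classical_set_scope.
Local Open Scope ring_scope.

(** The operator [T] is built pointwise.  On the positive cone put
    [p x := sup_l T_l x].  Since translations and multiplications by positive
    scalars are order automorphisms of [F], [p] is positively homogeneous, and
    since the index set is directed and [T_l] is increasing, [p] is additive
    ([directed_sup_add], [sup_scale]).  As [E] is directed, a map that is
    additive and positively homogeneous on the positive cone extends to a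
    linear map [f] on [E] ([cone_extension]).

    The net need not consist of regular operators, yet [f] lies in [V]: for any
    index [l0], the difference [f - T_l0] is positive, hence regular, hence in
    [V], and [f] is its sum with [T_l0].  That [f] is the supremum in [V], with
    the stated values on the cone, is then immediate because the order of [V]
    is the pointwise order on the cone ([pointwise_supremum]).

    This construction uses completeness of [F] only through the existence of
    the suprema [p x], so nets and sequences are treated at once
    ([bounded_iff_pointwise_bounded]). *)

Section Suprema.
Variables (R : realType) (F : povsType R).
Implicit Types (x y z : F) (a : R).

Lemma lev_subr_addr x y z : (x <= y - z) = (x + z <= y).
Proof. by rewrite -subv_ge0 -[RHS]subv_ge0 opprD [- x - z]addrC addrA. Qed.

Lemma lev_add x y x' y' : x <= y -> x' <= y' -> x + x' <= y + y'.
Proof.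
move=> xy xy'; apply: (le_trans (lev_add2l x _ _ xy')).
by rewrite ![_ + y']addrC; exact: lev_add2l.
Qed.

Lemma addv_ge0 x y : 0 <= x -> 0 <= y -> 0 <= x + y.
Proof. by move=> x0 y0; rewrite -[0]addr0; exact: lev_add. Qed.

Lemma lev_scale a x y : 0 <= a -> x <= y -> a *: x <= a *: y.
Proof.
by move=> a0; rewrite -subv_ge0 => /(scalev_ge0 _ _ a0); rewrite scalerBr subv_ge0.
Qed.

Lemma has_ubound_rangeP (L : Type) (u : L -> F) :
  has_ubound (range u) <-> exists b, forall i, u i <= b.
Proof.
split=> -[b ub]; exists b; first by move=> i; apply: ub; exists i.
by move=> _ [i _ <-].
Qed.

Lemma supremums_rangeP (L : Type) (u : L -> F) s :
  supremums (range u) s <->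
  (forall i, u i <= s) /\ (forall b, (forall i, u i <= b) -> s <= b).
Proof.
split=> -[us ls]; split.
- by move=> i; apply: us; exists i.
- by move=> b ub; apply: ls => _ [i _ <-].
- by move=> _ [i _ <-].
- by move=> b ub; apply: ls => i; apply: ub; exists i.
Qed.

Lemma supremums_unique (A : set F) s t :
  supremums A s -> supremums A t -> s = t.
Proof.
move=> [us ls] [ut lt]; apply/le_anti/andP.
by split; [exact: ls | exact: lt].
Qed.

Lemma sup_scale (L : Type) (u : L -> F) s a : 0 < a ->
  supremums (range u) s -> supremums (range (fun i => a *: u i)) (a *: s).
Proof.
move=> a0 /supremums_rangeP[us ls]; have a_neq0 : a != 0 by rewrite gt_eqF.
apply/supremums_rangeP; split=> [i|b ub]; first exact/lev_scale/us/ltW.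
rewrite -[b]scale1r -(divff a_neq0) -scalerA; apply: lev_scale (ltW a0) _.
apply: ls => i; rewrite -[u i]scale1r -(mulVf a_neq0) -scalerA.
by apply: lev_scale (ub i); rewrite invr_ge0 ltW.
Qed.

(** Directedness bounds each mixed sum [u i + v j] by a diagonal one
    [u k + v k]; translating by [v j], and then by the supremum of [u], takes
    the two suprema separately. *)
Lemma directed_sup_add (L : Type) (le : L -> L -> Prop) (u v : L -> F) s t :
  directed_set le -> increasing_net le u -> increasing_net le v ->
  supremums (range u) s -> supremums (range v) t ->
  supremums (range (fun i => u i + v i)) (s + t).
Proof.
move=> [_ _ _ dir] iu iv /supremums_rangeP[us ls] /supremums_rangeP[vt lt].
apply/supremums_rangeP; split=> [i|b ub]; first exact: lev_add.
rewrite addrC -lev_subr_addr; apply: lt => j.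
rewrite lev_subr_addr addrC -lev_subr_addr; apply: ls => i.
rewrite lev_subr_addr; have [k [ik jk]] := dir i j.
exact: le_trans (lev_add (iu _ _ ik) (iv _ _ jk)) (ub k).
Qed.

End Suprema.

(** Every vector is a difference of two positive ones, and additivity makes the
    value [p y - p z] independent of the choice of [y] and [z] with
    [x = y - z]; linearity follows by choosing convenient decompositions. *)
Lemma cone_extension (R : realType) (E : directedPovsType R) (F : lmodType R)
    (p : E -> F) :
  (forall x y, 0 <= x -> 0 <= y -> p (x + y) = p x + p y) ->
  (forall (a : R) x, 0 < a -> 0 <= x -> p (a *: x) = a *: p x) ->
  exists f : {linear E -> F}, forall x, 0 <= x -> f x = p x.
Proof.
move=> pD pZ.
have p0 : p 0 = 0 by apply: (addrI (p 0)); rewrite -pD // !addr0.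
have /choice[g gP] (x : E) : exists yz : E * E,
    [/\ 0 <= yz.1, 0 <= yz.2 & x = yz.1 - yz.2].
  by have [y [z [y0 z0 xE]]] := povs_directed x; exists (y, z).
pose f x := p (g x).1 - p (g x).2.
(* From [y - z = y' - z'] follows [y + z' = y' + z], a relation between
   positive vectors, to which additivity of [p] applies. *)
have fE y z : 0 <= y -> 0 <= z -> f (y - z) = p y - p z.
  rewrite /f; have [] := gP (y - z); case: (g _) => y' z' /= y'0 z'0 yzE y0 z0.
  apply/eqP; rewrite subr_eq addrAC eq_sym subr_eq -!pD //; apply/eqP; congr p.
  by rewrite -[y](subrK z) yzE addrAC subrK.
have fD x y : f (x + y) = f x + f y.
  have [x10 x20 xE] := gP x; have [y10 y20 yE] := gP y.
  rewrite {1}xE {1}yE addrACA -opprD fE ?addv_ge0 // !pD //.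
  by rewrite opprD addrACA.
have fN x : f (- x) = - f x.
  by have [x10 x20 xE] := gP x; rewrite {1}xE opprB fE // -opprB.
have fZpos a x : 0 < a -> f (a *: x) = a *: f x.
  move=> a0; have [x10 x20 xE] := gP x.
  by rewrite {1}xE scalerBr fE ?scalev_ge0 ?(ltW a0) // !pZ // -scalerBr.
have fZ a x : f (a *: x) = a *: f x.
  case: (ltgtP a 0) => [a0|a0|->]; last 2 first.
  - exact: fZpos.
  - by rewrite !scale0r -[0]subr0 fE // subrr.
  by rewrite -[a]opprK scaleNr fN fZpos ?oppr_gt0 // -scaleNr.
have f_lin : linear f by move=> a x y; rewrite fD fZ.
pose fL := GRing.isLinear.Build R E F *:%R f f_lin.
exists (HB.pack f fL : {linear E -> F}) => x x0 /=.
by rewrite -[x]subr0 fE // p0 !subr0.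
Qed.

Section OperatorNets.
Variables (R : realType) (E : directedPovsType R) (F : povsType R).
Variable V : submodClosed {linear E -> F}.
Hypothesis V_regular : forall T : {linear E -> F}, regular_op T -> T \in V.
Variables (L : Type) (le : L -> L -> Prop) (T_ : L -> opspace V).
Hypotheses (le_dir : directed_set le) (T_incr : increasing_net le T_).

Lemma pointwise_supremum :
  (forall x : E, 0 <= x ->
     exists s, supremums (range (fun l => val (T_ l) x)) s) ->
  exists T : opspace V, supremums (range T_) T /\
    forall x : E, 0 <= x ->
      supremums (range (fun l => val (T_ l) x)) (val T x).
Proof.
move=> sup_ex.
have incr x : 0 <= x -> increasing_net le (fun l => val (T_ l) x).
  by move=> x0 i j /T_incr /opspace_leP; exact.
(* Off the cone the value of [p] is immaterial; [0] makes it total. *)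
have /choice[p pP] (x : E) : exists s, 0 <= x ->
    supremums (range (fun l => val (T_ l) x)) s.
  case: (boolP (0 <= x)) => [/sup_ex[s sP]|_]; last by exists 0.
  by exists s.
have pD x y : 0 <= x -> 0 <= y -> p (x + y) = p x + p y.
  move=> x0 y0; apply: supremums_unique (pP _ (addv_ge0 x0 y0)) _.
  under eq_fun do rewrite linearD.
  exact: (directed_sup_add le_dir (incr _ x0) (incr _ y0) (pP _ x0) (pP _ y0)).
have pZ (a : R) x : 0 < a -> 0 <= x -> p (a *: x) = a *: p x.
  move=> a0 x0; apply: supremums_unique (pP _ (scalev_ge0 _ _ (ltW a0) x0)) _.
  under eq_fun do rewrite linearZ.
  exact: sup_scale (pP _ x0).
have [f fp] := cone_extension pD pZ.
have f_sup x : 0 <= x -> supremums (range (fun l => val (T_ l) x)) (f x).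
  by move=> x0; rewrite fp //; exact: pP.
have fV : f \in V.
  have [[l0] _ _ _] := le_dir.
  rewrite -(subrK (val (T_ l0)) f); apply: rpredD; last exact: valP.
  apply: V_regular; exists (f - val (T_ l0)), 0; split=> [x x0|x x0|].
  - rewrite linmap_subE subv_ge0.
    by have /supremums_rangeP[] := f_sup x x0.
  - exact: lexx.
  - by rewrite subr0.
exists (Sub f fV); split; last by move=> x x0; rewrite SubK; exact: f_sup.
apply/supremums_rangeP; split=> [l|U TU]; apply/opspace_leP => x x0;
  rewrite SubK; have /supremums_rangeP[ub lub] := f_sup x x0 => //.
by apply: lub => l; have /opspace_leP := TU l; exact.
Qed.

Lemma bounded_pointwise_bounded : has_ubound (range T_) ->
  forall x : E, 0 <= x -> has_ubound (range (fun l => val (T_ l) x)).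
Proof.
move=> /has_ubound_rangeP[U TU] x x0; apply/has_ubound_rangeP.
by exists (val U x) => l; have /opspace_leP := TU l; exact.
Qed.

(** The completeness hypothesis speaks only of nets over [(L, le)], so that it
    follows from monotone completeness for an arbitrary index set, and from
    its sequential version when [L] is [nat]. *)
Lemma bounded_iff_pointwise_bounded :
  (forall u : L -> F, increasing_net le u -> has_ubound (range u) ->
     exists s, supremums (range u) s) ->
  (has_ubound (range T_) <->
     forall x : E, 0 <= x -> has_ubound (range (fun l => val (T_ l) x))) /\
  (has_ubound (range T_) ->
     exists T : opspace V, supremums (range T_) T /\
       forall x : E, 0 <= x ->
         supremums (range (fun l => val (T_ l) x)) (val T x)).
Proof.
move=> F_compl.
have sup_ex :
    (forall x : E, 0 <= x -> has_ubound (range (fun l => val (T_ l) x))) ->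
    exists T : opspace V, supremums (range T_) T /\
      forall x : E, 0 <= x ->
        supremums (range (fun l => val (T_ l) x)) (val T x).
  move=> bnd; apply: pointwise_supremum => x x0; apply: F_compl (bnd x x0).
  by move=> i j /T_incr /opspace_leP; exact.
split; last by move=> /bounded_pointwise_bounded /sup_ex.
split; first exact: bounded_pointwise_bounded.
by move=> /sup_ex[T [[ubT _] _]]; exists T.
Qed.

End OperatorNets.

Lemma directed_nat : directed_set (fun m n : nat => (m <= n)%N).
Proof.
split=> [|n|i j k|i j].
- exact: (inhabits 0%N).
- exact: leqnn.
- exact: leq_trans.
by exists (maxn i j); rewrite leq_maxl leq_maxr.
Qed.

Theorem proposition3p1 (R : realType) (E : directedPovsType R) (F : povsType R)
    (V : submodClosed {linear E -> F})
    (hV : forall T : {linear E -> F}, regular_op T -> T \in V) :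
  (monotone_complete F ->
    (forall (L : Type) (le : L -> L -> Prop) (T_ : L -> opspace V),
       directed_set le -> increasing_net le T_ ->
       (has_ubound (range T_) <->
          forall x : E, 0 <= x -> has_ubound (range (fun l => val (T_ l) x))) /\
       (has_ubound (range T_) ->
          exists T : opspace V, supremums (range T_) T /\
            forall x : E, 0 <= x ->
              supremums (range (fun l => val (T_ l) x)) (val T x))) /\
    monotone_complete (opspace V)) /\
  (sigma_monotone_complete F ->
    (forall T_ : nat -> opspace V,
       increasing_seq T_ ->
       (has_ubound (range T_) <->
          forall x : E, 0 <= x -> has_ubound (range (fun n => val (T_ n) x))) /\
       (has_ubound (range T_) ->
          exists T : opspace V, supremums (range T_) T /\
            forall x : E, 0 <= x ->
              supremums (range (fun n => val (T_ n) x)) (val T x))) /\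
    sigma_monotone_complete (opspace V)).
Proof.
split=> F_compl.
  have main L le (T_ : L -> opspace V) (dir : directed_set le)
      (incr : increasing_net le T_) :=
    bounded_iff_pointwise_bounded hV dir incr (fun u => F_compl L le u dir).
  split; first exact: main.
  move=> L le T_ dir incr bnd.
  by have [_ /(_ bnd)[T []]] := main L le T_ dir incr; exists T.
have main (T_ : nat -> opspace V) (incr : increasing_seq T_) :=
  bounded_iff_pointwise_bounded hV directed_nat incr F_compl.
split; first exact: main.
move=> T_ incr bnd.
by have [_ /(_ bnd)[T []]] := main T_ incr; exists T.
Qed.
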